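(* Let $G=(\mathcal{N},\mathcal{E})$ be a connected graph with $n$ nodes and $m$ edges, each edge given an arbitrary fixed orientation, with incidence matrix $A$, let $D=\mathrm{diag}(\tilde b_e)_{e\in\mathcal{E}}$ with all $\tilde b_e>0$, let $L=ADA^\top$ with Moore–Penrose pseudoinverse $L^\dagger$, and let $C_\Sigma\in\mathbb{R}^{m\times q}$, $q=m-n+1$, be a cycle basis matrix of $G$. Let $P\in\mathbb{R}^n$ with $\mathbb{1}^\top P=0$. Define $\hat f=DA^\top L^\dagger P$ and, for $\lambda\in\mathbb{R}^q$, $$f(\lambda)=\hat f+C_\Sigma\lambda,\qquad z(\lambda)=D^{-1}f(\lambda)=z_0+H\lambda\ \ (z_0=D^{-1}\hat f,\ H=D^{-1}C_\Sigma),\qquad g(\lambda)=C_\Sigma^\top\arcsin(z(\lambda)),$$ with $\arcsin$ applied componentwise. Let $\underline\lambda,\bar\lambda\in\mathbb{R}^q$ with $\underline\lambda\le\bar\lambda$ componentwise and $\Lambda=\{\lambda\in\mathbb{R}^q:\underline\lambda\le\lambda\le\bar\lambda\}$. Suppose: (1) $|z_e(\lambda)|\le 1$ for all $e\in\mathcal{E}$ and all $\lambda\in\Lambda$; (2) for every $i\in\{1,\dots,q\}$, the component $g_i$ is non-decreasing in each coordinate $\lambda_j$ ($j=1,\dots,q$) on $\Lambda$; (3) for every $i\in\{1,\dots,q\}$, $$g_i(\bar\lambda_1,\dots,\bar\lambda_{i-1},\underline\lambda_i,\bar\lambda_{i+1},\dots,\bar\lambda_q)\le 0,\qquad g_i(\underline\lambda_1,\dots,\underline\lambda_{i-1},\bar\lambda_i,\underline\lambda_{i+1},\dots,\underline\lambda_q)\ge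 0.$$ Then there exists $\lambda^*\in\Lambda$ with $g(\lambda^* )=0$. Consequently there exists $\theta\in\mathbb{R}^n$ solving the lossless real power flow equation $P=AD\sin(A^\top\theta)$ (sine componentwise), with $|\theta_i-\theta_j|\le\pi/2$ for every edge $(i,j)\in\mathcal{E}$.
   Context: The incidence matrix $A$ has entries $A_{ke}=+1$ if node $k$ is the source of edge $e$, $A_{ke}=-1$ if $k$ is the sink of $e$, and $0$ otherwise. $\mathbb{1}$ is the all-ones vector. A cycle vector $c\in\mathbb{R}^m$ of a cycle (with a chosen traversal direction) has $c_e=+1$ if edge $e$ is in the cycle with orientation agreeing with the traversal, $-1$ if it is in the cycle with opposite orientation, and $0$ otherwise; a cycle basis matrix $C_\Sigma$ has as columns linearly independent cycle vectors spanning $\ker(A)$. Inequalities between vectors are componentwise. *)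

(* Defs.v *)
From HB Require Import structures.
From mathcomp Require Import all_boot all_order all_algebra.
From mathcomp Require Import reals trigo.
Set Implicit Arguments. Unset Strict Implicit. Unset Printing Implicit Defensive.
Import Order.TTheory GRing.Theory Num.Theory.
Local Open Scope ring_scope.

Section Defs.
Variables (R : realType) (n m : nat).
Variables (src dst : 'I_m -> 'I_n).

Definition adj : rel 'I_n := fun x y =>
  [exists e, ((src e == x) && (dst e == y)) || ((src e == y) && (dst e == x))].

Definition connected_graph : Prop := forall x y : 'I_n, connect adj x y.

Definition incidence : 'M[R]_(n, m) :=
  \matrix_(k, e) (if src e == k then 1 else if dst e == k then -1 else 0).

Definition is_cycle (k : nat) (v : 'I_k.+2 -> 'I_n) (w : 'I_k.+2 -> 'I_m) : Prop :=
  injective v /\ injective w /\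
  forall i : 'I_k.+2,
    ((src (w i) == v i) && (dst (w i) == v (ordS i))) ||
    ((src (w i) == v (ordS i)) && (dst (w i) == v i)).

(* its cycle vector: +1 if the edge is traversed along its orientation, -1 if
   against it, 0 if not in the cycle *)
Definition cycle_vec (k : nat) (v : 'I_k.+2 -> 'I_n) (w : 'I_k.+2 -> 'I_m)
  : 'cV[R]_m :=
  \col_e (\sum_(i < k.+2) if w i == e then (if src e == v i then 1 else -1) else 0).

Definition is_cycle_vector (c : 'cV[R]_m) : Prop :=
  exists k v w, @is_cycle k v w /\ c = @cycle_vec k v w.

Definition is_cycle_basis (q : nat) (C : 'M[R]_(m, q)) : Prop :=
  (forall j : 'I_q, is_cycle_vector (col j C)) /\
  \rank C = q /\
  (forall x : 'cV[R]_m, incidence *m x = 0 -> exists l : 'cV[R]_q, x = C *m l).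
End Defs.

Definition is_MP_pinv (R : realType) (k : nat) (L X : 'M[R]_k) : Prop :=
  [/\ L *m X *m L = L, X *m L *m X = X,
      (L *m X)^T = L *m X & (X *m L)^T = X *m L].

Definition diagm (R : realType) (m : nat) (b : 'I_m -> R) : 'M[R]_m :=
  diag_mx (\row_e b e).

Definition in_box (R : realType) (q : nat) (lo hi l : 'cV[R]_q) : Prop :=
  forall j, lo j 0 <= l j 0 <= hi j 0.

(* Main.v *)
(* The map g is the gradient of the convex function F(l) = sum_e b_e Phi(z_e(l)),
   Phi(x) = x asin x + sqrt (1 - x^2). Let ls minimize F over the compact box. At a
   coordinate where ls_i < hi_i the optimality condition gives g_i(ls) >= 0, and where
   ls_i = hi_i monotonicity compares g_i(ls) with the face condition (3), giving the
   same sign; symmetrically g_i(ls) <= 0. Hence g(ls) = 0, without any fixed-point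
   theorem. Then asin z(ls) is orthogonal to ker A, so it equals A^T theta, and
   P = A D z(ls) because A C = 0 and L Lp P = P (ker L consists of the constant
   vectors, the graph being connected). *)
Require Import Defs.
From HB Require Import structures.
From mathcomp Require Import all_boot all_order all_algebra.
From mathcomp Require Import boolp classical_sets reals topology normedtype derive realfun trigo.
From mathcomp Require Import lra.
Set Implicit Arguments.
Unset Strict Implicit.
Unset Printing Implicit Defensive.
Import Order.TTheory GRing.Theory Num.Theory.
Import numFieldNormedType.Exports.
Local Open Scope ring_scope.

(** * Diagonal weights and the incidence matrix *)

Lemma diagm_mulE (R : realType) (m k : nat) (b : 'I_m -> R) (M : 'M[R]_(m, k)) i j :
  (diagm b *m M) i j = b i * M i j.
Proof. by rewrite /diagm mul_diag_mx !mxE. Qed.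

Lemma diagm_mulVK (R : realType) (m k : nat) (b : 'I_m -> R) (M : 'M[R]_(m, k)) :
  (forall e, 0 < b e) -> diagm b *m (diagm (fun e => (b e)^-1) *m M) = M.
Proof.
move=> b_gt0; apply/matrixP=> i j.
by rewrite !diagm_mulE mulVKf // gt_eqF.
Qed.

Section Incidence.
Variables (R : realType) (n m : nat) (src dst : 'I_m -> 'I_n).
Hypothesis noloop : forall e, src e != dst e.
Let A := incidence R src dst.

(** Excluding loops matters here: for a loop, [incidence] would record a lone +1 instead of
    cancelling contributions. *)
Lemma mul_incidence_trE (k : nat) (M : 'M[R]_(n, k)) e j :
  (A^T *m M) e j = M (src e) j - M (dst e) j.
Proof.
rewrite mxE (bigD1 (src e)) //= (bigD1 (dst e)) ?(eq_sym (dst e)) //= big1 ?addr0.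
  by rewrite !mxE !eqxx (negPf (noloop e)) mul1r mulN1r.
move=> i /andP[ne_s ne_d].
by rewrite !mxE ![_ == i]eq_sym (negPf ne_s) (negPf ne_d) mul0r.
Qed.

Lemma const_mul_incidence (k : nat) (a : R) : const_mx a *m A = 0 :> 'M_(k, m).
Proof.
apply/trmx_inj; rewrite trmx_mul trmx_const trmx0.
by apply/matrixP=> e j; rewrite mul_incidence_trE !mxE subrr.
Qed.

(** Each edge equation equates the values at its two ends; induction along a connecting path
    propagates this. *)
Lemma incidence_tr_eq0 (x : 'cV[R]_n) :
  connected_graph src dst -> A^T *m x = 0 -> forall i j, x i 0 = x j 0.
Proof.
move=> conn /matrixP Ax0 i j.
have [p + ->] := connectP (conn i j).
elim: p i => [|k p IHp] i //= /andP[/existsP[e ik] /IHp <-].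
have := Ax0 e 0; rewrite mul_incidence_trE mxE => /subr0_eq.
by case/orP: ik => /andP[/eqP-> /eqP->].
Qed.

(** The all-ones row is a nonzero element of the left kernel. *)
Lemma mxrank_incidence : (0 < n)%N -> (\rank A < n)%N.
Proof.
move=> n_gt0; have := mulmx0_rank_max (const_mul_incidence 1 1).
suff -> : \rank (const_mx 1 : 'rV[R]_n) = 1%N by rewrite add1n.
apply/eqP; rewrite eqn_leq rank_leq_row lt0n mxrank_eq0; apply/eqP.
by move/matrixP/(_ 0 (Ordinal n_gt0))/eqP; rewrite !mxE oner_eq0.
Qed.

End Incidence.

(** * Matrices whose columns span a kernel *)

Lemma spanning_factor (F : fieldType) (n m q k : nat) (A : 'M[F]_(n, m))
    (C : 'M[F]_(m, q)) (X : 'M[F]_(m, k)) :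
  (forall x : 'cV_m, A *m x = 0 -> exists l : 'cV_q, x = C *m l) ->
  A *m X = 0 -> exists N : 'M_(q, k), X = C *m N.
Proof.
move=> spanC AX0.
suff /submxP[N XN] : (X^T <= C^T)%MS.
  by exists N^T; apply/trmx_inj; rewrite trmx_mul trmxK.
apply/row_subP=> j; rewrite -tr_col.
have [|l ->] := spanC (col j X); last by rewrite trmx_mul submxMl.
by rewrite colE mulmxA AX0 mul0mx.
Qed.

(** The columns of [cokermx A] lie in ker A, hence in the span of C, so [y^T] annihilates them; this
    is the criterion for [y^T] to be in the row space of A. *)
Lemma orthogonal_kernel (F : fieldType) (n m q : nat) (A : 'M[F]_(n, m))
    (C : 'M[F]_(m, q)) (y : 'cV[F]_m) :
  (forall x : 'cV_m, A *m x = 0 -> exists l : 'cV_q, x = C *m l) ->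
  C^T *m y = 0 -> exists th : 'cV_n, y = A^T *m th.
Proof.
move=> spanC Cy0.
suff /submxP[t yt] : (y^T <= A)%MS.
  by exists t^T; apply/trmx_inj; rewrite trmx_mul !trmxK.
have [N kerE] := spanning_factor spanC (mulmx_coker A).
have yC0 : y^T *m C = 0 by apply/trmx_inj; rewrite trmx_mul trmxK Cy0 trmx0.
by rewrite submxE kerE mulmxA yC0 mul0mx.
Qed.

(* Rank-nullity: the column space of C contains ker A and is no larger. *)
Lemma spanning_kernel (F : fieldType) (n m q : nat) (A : 'M[F]_(n, m))
    (C : 'M[F]_(m, q)) :
  (forall x : 'cV_m, A *m x = 0 -> exists l : 'cV_q, x = C *m l) ->
  (\rank C <= m - \rank A)%N -> A *m C = 0.
Proof.
move=> spanC rkC.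
have [N kerE] := spanning_factor spanC (mulmx_coker A).
have kerC : ((cokermx A)^T <= C^T)%MS by rewrite kerE trmx_mul submxMl.
have [] := mxrank_leqif_sup kerC; rewrite !mxrank_tr mxrank_coker => le_rk.
rewrite eqn_leq le_rk rkC => /esym/submxP[M CE].
have -> : C = cokermx A *m M^T by apply/trmx_inj; rewrite trmx_mul trmxK.
by rewrite mulmxA mulmx_coker mul0mx.
Qed.

(** * The weighted Laplacian and its pseudoinverse *)

(** The quadratic form at x is the sum of b_e (A^T x)_e^2, with all weights positive. *)
Lemma weighted_gram_eq0 (R : realType) (n m : nat) (b : 'I_m -> R) (A : 'M[R]_(n, m))
    (x : 'cV[R]_n) :
  (forall e, 0 < b e) -> A *m diagm b *m A^T *m x = 0 -> A^T *m x = 0.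
Proof.
move=> b_gt0 Lx0.
have : ((A^T *m x)^T *m (diagm b *m (A^T *m x))) 0 0 = 0.
  suff -> : (A^T *m x)^T *m (diagm b *m (A^T *m x)) =
            x^T *m (A *m diagm b *m A^T *m x) by rewrite Lx0 mulmx0 mxE.
  by rewrite trmx_mul trmxK !mulmxA.
rewrite mxE => /eqP; rewrite psumr_eq0 => [|e _]; last first.
  by rewrite diagm_mulE mxE mulrCA -expr2 mulr_ge0 ?sqr_ge0 // ltW.
move/allP=> y0; apply/matrixP=> e j; rewrite ord1 [RHS]mxE.
move: (y0 e (mem_index_enum _)) => /=; rewrite diagm_mulE mxE mulrCA -expr2.
by rewrite mulf_eq0 gt_eqF //= sqrf_eq0 => /eqP.
Qed.

Lemma laplacian_ker0 (R : realType) (n m : nat) (src dst : 'I_m -> 'I_n)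
    (b : 'I_m -> R) (x : 'cV[R]_n) :
  (forall e, src e != dst e) -> connected_graph src dst -> (forall e, 0 < b e) ->
  let A := incidence R src dst in
  A *m diagm b *m A^T *m x = 0 -> \sum_i x i 0 = 0 -> x = 0.
Proof.
move=> noloop conn b_gt0 A Lx0 sumx.
have x_const := incidence_tr_eq0 noloop conn (weighted_gram_eq0 b_gt0 Lx0).
apply/matrixP=> i j; rewrite ord1 mxE; move: sumx.
rewrite (eq_bigr (fun=> x i 0)) => [|k _]; last exact: x_const.
rewrite sumr_const card_ord => /eqP; rewrite mulrn_eq0 eqn0Ngt.
by rewrite (leq_ltn_trans (leq0n i) (ltn_ord i)) /= => /eqP.
Qed.

(** The residual P - L Lp P lies in ker L, since transposing L Lp L = L gives L L Lp = L, and its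
    entries sum to 0, since the all-ones row annihilates both P and A. Hence it vanishes. *)
Lemma laplacian_pinv (R : realType) (n m : nat) (src dst : 'I_m -> 'I_n)
    (b : 'I_m -> R) (Lp : 'M[R]_n) (P : 'cV[R]_n) :
  (forall e, src e != dst e) -> connected_graph src dst -> (forall e, 0 < b e) ->
  let A := incidence R src dst in let L := A *m diagm b *m A^T in
  is_MP_pinv L Lp -> \sum_i P i 0 = 0 -> L *m Lp *m P = P.
Proof.
move=> noloop conn b_gt0 A L [LXL _ LX_sym _] sumP.
have L_sym : L^T = L by rewrite /L !trmx_mul trmxK tr_diag_mx mulmxA.
suff : P - L *m Lp *m P = 0 by move/subr0_eq.
have sumE (x : 'cV[R]_n) : \sum_i x i 0 = (const_mx 1 *m x : 'M_1) 0 0.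
  by rewrite mxE; apply: eq_bigr => k _; rewrite mxE mul1r.
apply: (laplacian_ker0 noloop conn b_gt0).
  have LLX : L *m (L *m Lp) = L.
    by apply/trmx_inj; rewrite trmx_mul LX_sym L_sym LXL.
  by rewrite -/A -/L mulmxBr (mulmxA L) LLX subrr.
by rewrite sumE mulmxBr !mulmxA const_mul_incidence // !mul0mx subr0 -sumE.
Qed.

(** * The arcsine, its primitive and convexity *)

Local Open Scope classical_set_scope.

(* The library's asin is unspecified outside [-1, 1]; composing with clamp gives
   a function that is continuous on the whole line. *)
Definition clamp (R : realType) (x : R) : R := Order.max (-1) (Order.min x 1).
Definition asinc (R : realType) (x : R) : R := asin (clamp x).

Lemma clamp_itv (R : realType) (x : R) : -1 <= clamp x <= 1.
Proof.
by rewrite /clamp le_max ge_max ge_min !lexx orbT (le_trans (lerN10 R) ler01).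
Qed.

Lemma asinc_def (R : realType) (x : R) : `|x| <= 1 -> asinc x = asin x.
Proof. by rewrite /asinc /clamp ler_norml => /andP[? ?]; rewrite min_l // max_r. Qed.

Lemma continuous_clamp (R : realType) : continuous (@clamp R).
Proof.
move=> x; apply: (@continuous_max R R (fun=> -1) (fun x => Order.min x 1)).
  exact: cst_continuous.
by apply: (@continuous_min R R id (fun=> 1)); [exact: cvg_id | exact: cst_continuous].
Qed.

Lemma continuous_asinc (R : realType) : continuous (@asinc R).
Proof.
have le_pi : - (pi / 2) <= pi / 2 :> R by have := @pi_gt0 R; lra.
have csin : {within `[- (pi / 2), pi / 2 : R], continuous sin}.
  by apply: continuous_subspaceT => x; exact: continuous_sin.
have := segment_can_le_continuous le_pi csin (@sinK R).
rewrite sinN sin_pihalf => casin x.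
have cx : `[-1, 1 : R] (clamp x) by rewrite /= in_itv /= clamp_itv.
(* [clamp] takes values in [-1, 1], so its limit may be taken within that segment, where [asin] is
   continuous as the inverse of sin. *)
have cw : clamp y @[y --> x] --> within `[-1, 1] (nbhs (clamp x)).
  move=> B; rewrite /within /= => nB.
  have := @continuous_clamp R x _ nB; rewrite /= !nbhs_simpl /=.
  apply: filterS => y /= yB; apply: yB.
  by rewrite in_itv /= clamp_itv.
apply: (cvg_comp _ _ cw) => B nB.
suff : @nbhs_subspace R `[-1, 1 : R] (clamp x) (@asin R @^-1` B).
  by rewrite -(nbhs_subspace_in cx).
exact: (casin (clamp x) B nB).
Qed.

(** Concavity: cos lies below its tangent at b. The mean value theorem yields sin c with c between a
    and b, and sin is increasing on this interval. *)
Lemma cos_sub_ge (R : realType) (a b : R) :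
  - (pi / 2) <= a <= pi / 2 -> - (pi / 2) <= b <= pi / 2 ->
  cos a - cos b <= (b - a) * sin b.
Proof.
have sin_le (x y : R) : - (pi / 2) <= x -> x <= y -> y <= pi / 2 -> sin x <= sin y.
  move=> xl xy yr; rewrite (le_mono_in (monoW_in (@ltr_sin R))) // in_itv /=.
    by rewrite xl (le_trans xy).
  by rewrite yr (le_trans xl).
have dcos (x : R) : is_derive x 1 cos (- sin x) by exact: is_derive_cos.
have ccos (x y : R) : {within `[x, y], continuous (@cos R)}.
  by apply: continuous_subspaceT => ?; exact: continuous_cos.
move=> /andP[al ar] /andP[bl br]; case: (leP a b) => [le_ab|/ltW le_ba].
  have [c /itvP c_itv /eqP] := MVT_segment le_ab (fun x _ => dcos x) (ccos a b).
  rewrite -(inj_eq (@oppr_inj _)) opprB => /eqP ->.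
  rewrite mulNr opprK mulrC ler_wpM2l ?subr_ge0 // sin_le ?c_itv //.
  by rewrite (le_trans al) ?c_itv.
have [c /itvP c_itv ->] := MVT_segment le_ba (fun x _ => dcos x) (ccos b a).
rewrite -(opprB a b) [leRHS]mulNr mulNr lerN2 mulrC ler_wpM2r ?subr_ge0 //.
  by rewrite sin_le ?c_itv // (le_trans _ ar) ?c_itv.
Qed.

(** On [-1, 1] the second term is sqrt (1 - x^2). The cosine form reduces convexity to a tangent
    inequality for cos. *)
Definition asin_primitive (R : realType) (x : R) : R := x * asinc x + cos (asinc x).

Lemma continuous_asin_primitive (R : realType) : continuous (@asin_primitive R).
Proof.
move=> x; have casin := @continuous_asinc R x.
apply: cvgD; first by apply: cvgM; [exact: cvg_id | exact: casin].
by apply: (cvg_comp _ _ casin); exact: continuous_cos.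
Qed.

(** This is [cos_sub_ge] at a = asin y, b = asin x, where sin b = x. *)
Lemma asin_primitive_convex (R : realType) (x y : R) : `|x| <= 1 -> `|y| <= 1 ->
  asin_primitive y - asin_primitive x <= asinc y * (y - x).
Proof.
move=> x1 y1; rewrite /asin_primitive !asinc_def //.
have asinB (t : R) : `|t| <= 1 -> - (pi / 2) <= asin t <= pi / 2.
  by rewrite ler_norml => t1; rewrite asin_geNpi2 ?asin_lepi2.
have := cos_sub_ge (asinB _ y1) (asinB _ x1).
by rewrite asinK ?in_itv /= -?ler_norml //; lra.
Qed.

(** * Minimization over a box *)

Lemma ge0_at0_of_right (R : realType) (h : R -> R) (d : R) : 0 < d ->
  {for 0, continuous h} -> (forall t, 0 < t <= d -> 0 <= h t) -> 0 <= h 0.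
Proof.
move=> d_gt0 h_cont h_ge0; rewrite leNgt; apply/negP => h0_lt0.
have h_lt0 : \forall t \near 0^'+, h t < 0.
  apply: (cvgr_lt (h 0)) => //; exact: cvg_at_right_filter.
near (0 : R)^'+ => t.
have : h t < 0 by near: t.
rewrite ltNge h_ge0 //; apply/andP; split; near: t.
  exact: nbhs_right_gt.
exact: nbhs_right_le.
Unshelve. all: by end_near. Qed.

(** Coordinates are switched from l to l' one at a time; every intermediate vector [mix p] stays in
    the box. *)
Lemma in_box_mono (R : realType) (q : nat) (lo hi : 'cV[R]_q) (h : 'cV[R]_q -> R) :
  (forall (j : 'I_q) (l l' : 'cV[R]_q), in_box lo hi l -> in_box lo hi l' ->
      (forall k, k != j -> l k 0 = l' k 0) -> l j 0 <= l' j 0 -> h l <= h l') ->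
  forall l l', in_box lo hi l -> in_box lo hi l' ->
  (forall j, l j 0 <= l' j 0) -> h l <= h l'.
Proof.
move=> h_mono l l' l_box l'_box le_ll'.
pose mix p : 'cV[R]_q := \col_k (if (k < p)%N then l' k 0 else l k 0).
have mix_box p : in_box lo hi (mix p) by move=> j; rewrite mxE; case: ifP.
suff h_mix p : (p <= q)%N -> h l <= h (mix p).
  apply: (le_trans (h_mix q (leqnn q))); rewrite le_eqVlt; apply/orP; left.
  by apply/eqP; congr h; apply/matrixP=> i j; rewrite mxE ltn_ord ord1.
elim: p => [_|p IHp lt_pq].
  rewrite le_eqVlt; apply/orP; left.
  by apply/eqP; congr h; apply/matrixP=> i j; rewrite mxE ltn0 ord1.
apply: (le_trans (IHp (ltnW lt_pq))).
apply: (h_mono (Ordinal lt_pq)) => // [k ne_kp|]; rewrite !mxE /=.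
  by rewrite ltnS [in RHS]leq_eqVlt (negPf (ne_kp : val k != p)).
by rewrite ltnn ltnSn.
Qed.

(* The last-but-two hypothesis is the subgradient inequality taken at the far point l',
   so g ls is reached only as a limit along an edge direction and no derivative of F
   is needed. *)
Lemma box_gradient_root (R : realType) (q : nat) (lo hi : 'cV[R]_q)
    (F : 'cV[R]_q -> R) (g : 'cV[R]_q -> 'cV[R]_q) :
  (forall j, lo j 0 <= hi j 0) ->
  continuous (fun u : 'rV[R]_q => F u^T) ->
  (forall l i, continuous (fun t : R => g (l + t *: delta_mx i 0) i 0)) ->
  (forall l l', in_box lo hi l -> in_box lo hi l' ->
    F l' - F l <= ((g l')^T *m (l' - l)) 0 0) ->
  (forall (i j : 'I_q) (l l' : 'cV[R]_q), in_box lo hi l -> in_box lo hi l' ->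
      (forall k, k != j -> l k 0 = l' k 0) -> l j 0 <= l' j 0 ->
      g l i 0 <= g l' i 0) ->
  (forall i, g (\col_k (if k == i then lo k 0 else hi k 0)) i 0 <= 0 /\
             0 <= g (\col_k (if k == i then hi k 0 else lo k 0)) i 0) ->
  exists ls, in_box lo hi ls /\ g ls = 0.
Proof.
move=> lohi F_cont g_cont F_convex g_mono g_faces.
have [ls ls_box ls_min] : exists2 ls, in_box lo hi ls &
    forall l, in_box lo hi l -> F ls <= F l.
  pose box := [set u : 'rV[R]_q | forall i, `[lo i 0, hi i 0] (u ord0 i)].
  have boxP u : u \in box <-> in_box lo hi u^T.
    by rewrite inE; split=> u_box i; have := u_box i; rewrite /= in_itv /= mxE.
  have lo_box : in_box lo hi lo by move=> i; rewrite lexx lohi.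
  have box_compact : compact box 
    by apply: (@rV_compact R q (fun i => `[lo i 0, hi i 0])) => i; exact: segment_compact.
  have box0 : box !=set0 by exists lo^T; apply/set_mem/boxP; rewrite trmxK.
  have [u /boxP u_box u_min] := EVT_min_rV box0 box_compact (continuous_subspaceT F_cont).
  exists u^T => // l l_box.
  by rewrite -[l]trmxK; apply/u_min/boxP; rewrite trmxK.
exists ls; split=> //.
pose shift i t : 'cV[R]_q := ls + t *: delta_mx i 0.
have shiftE i t k : shift i t k 0 = if k == i then ls k 0 + t else ls k 0.
  by rewrite !mxE eqxx andbT; case: eqP; rewrite ?mulr1 ?mulr0 ?addr0.
have shift0 i : shift i 0 = ls by rewrite /shift scale0r addr0.
have shift_box i t : lo i 0 <= ls i 0 + t <= hi i 0 -> in_box lo hi (shift i t).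
  by move=> t_box k; rewrite shiftE; case: eqP => [->|_] //; exact: ls_box.
(* Minimality and convexity give 0 <= F (shift i t) - F ls <= t * g_i (shift i t), for t of either
   sign. *)
have shift_grad i t : lo i 0 <= ls i 0 + t <= hi i 0 -> 0 <= t * g (shift i t) i 0.
  move=> /shift_box t_box; have := F_convex _ _ ls_box t_box.
  have -> : shift i t - ls = t *: delta_mx i 0 by rewrite /shift addrAC subrr add0r.
  rewrite -scalemxAr -colE mxE [col _ _ _ _]mxE [_^T _ _]mxE; apply: le_trans.
  by rewrite subr_ge0 ls_min.
have mono i := in_box_mono (g_mono i).
apply/matrixP=> i j; rewrite ord1 mxE {j}; apply/le_anti/andP; split.
  (* If ls_i is at its lower end, ls lies below the first face point of (3) in every coordinate.
     Otherwise there is room to move by -t, and t tends to 0. *)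
  have [le_lo|gt_lo] := leP (ls i 0) (lo i 0).
    apply: le_trans (proj1 (g_faces i)); apply: mono => // k; rewrite ?mxE.
      by case: eqP; rewrite ?lexx ?lohi.
    by case: eqP => [->//|_]; case/andP: (ls_box k).
  rewrite -oppr_ge0 -(shift0 i) -[X in shift i X]oppr0.
  apply: (ge0_at0_of_right (h := fun t => - g (shift i (- t)) i 0)
           (d := ls i 0 - lo i 0)); first by rewrite subr_gt0.
    apply: cvgN.
    have := @continuous_comp R R R (@Algebra.opp R) (fun t => g (shift i t) i 0) 0.
    by apply; [exact: oppr_continuous | exact: g_cont].
  move=> t /andP[t_gt0 t_le].
  rewrite -(pmulr_rge0 _ t_gt0) mulrN -mulNr shift_grad //.
  case/andP: (ls_box i) => *; apply/andP; split; lra.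
have [ge_hi|lt_hi] := leP (hi i 0) (ls i 0).
  apply: le_trans (proj2 (g_faces i)) _; apply: mono => // k; rewrite ?mxE.
    by case: eqP; rewrite ?lexx ?lohi.
  by case: eqP => [->//|_]; case/andP: (ls_box k).
rewrite -(shift0 i).
apply: (ge0_at0_of_right (h := fun t => g (shift i t) i 0)
         (d := hi i 0 - ls i 0)); first by rewrite subr_gt0.
  exact: g_cont.
move=> t /andP[t_gt0 t_le]; rewrite -(pmulr_rge0 _ t_gt0) shift_grad //.
case/andP: (ls_box i) => *; apply/andP; split; lra.
Qed.

Lemma continuous_mull (R : realType) (T : topologicalType) (c : R) (f : T -> R) :
  continuous f -> continuous (fun x => c * f x).
Proof. by move=> f_cont x; apply: cvgM; [exact: cvg_cst | exact: f_cont]. Qed.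

Lemma continuous_sum (R : realType) (T : topologicalType) (I : finType) (f : I -> T -> R) :
  (forall i, continuous (f i)) -> continuous (fun x => \sum_i f i x).
Proof.
move=> f_cont; elim: (index_enum I) => [|i s IHs].
  by under eq_fun do rewrite big_nil; exact: cst_continuous.
under eq_fun do rewrite big_cons; move=> x.
by apply: cvgD; [exact: f_cont | exact: IHs].
Qed.

Lemma continuous_mulmx_coord (R : realType) (T : topologicalType) (m q : nat)
    (M : 'M[R]_(m, q)) (X : T -> 'cV[R]_q) (e : 'I_m) :
  (forall i, continuous (fun x => X x i 0)) -> continuous (fun x => (M *m X x) e 0).
Proof.
move=> X_cont; under eq_fun do rewrite mxE.
by apply: continuous_sum => i; exact: continuous_mull.
Qed.

(** * The root of g and the recovery of the phase angles *)

Theorem theorem1 (R : realType) (n m : nat) (src dst : 'I_m -> 'I_n)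
  (b : 'I_m -> R) (Lp : 'M[R]_n) (C : 'M[R]_(m, m.+1 - n)) (P : 'cV[R]_n)
  (lo hi : 'cV[R]_(m.+1 - n)) :
  (0 < n)%N ->
  (forall e, src e != dst e) ->
  connected_graph src dst ->
  (forall e, 0 < b e) ->
  is_MP_pinv (incidence R src dst *m diagm b *m (incidence R src dst)^T) Lp ->
  is_cycle_basis src dst C ->
  \sum_(i < n) P i 0 = 0 ->
  (forall j, lo j 0 <= hi j 0) ->
  let A := incidence R src dst in
  let D := diagm b in
  let Dinv := diagm (fun e => (b e)^-1) in
  let fhat := D *m A^T *m Lp *m P in
  let z := fun l : 'cV[R]_(m.+1 - n) => Dinv *m fhat + (Dinv *m C) *m l in
  let g := fun l : 'cV[R]_(m.+1 - n) => C^T *m map_mx asin (z l) in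
  (* (1) *)
  (forall l, in_box lo hi l -> forall e, `|z l e 0| <= 1) ->
  (* (2) monotonicity of each g_i in each coordinate on the box *)
  (forall (i j : 'I_(m.+1 - n)) (l l' : 'cV[R]_(m.+1 - n)),
      in_box lo hi l -> in_box lo hi l' ->
      (forall k, k != j -> l k 0 = l' k 0) -> l j 0 <= l' j 0 ->
      g l i 0 <= g l' i 0) ->
  (* (3) sign conditions on the faces *)
  (forall i : 'I_(m.+1 - n),
      g (\col_k (if k == i then lo k 0 else hi k 0)) i 0 <= 0 /\
      0 <= g (\col_k (if k == i then hi k 0 else lo k 0)) i 0) ->
  (exists ls, in_box lo hi ls /\ g ls = 0) /\
  (exists theta : 'cV[R]_n,
      P = A *m D *m map_mx sin (A^T *m theta) /\
      forall e, `|theta (src e) 0 - theta (dst e) 0| <= pi / 2).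
Proof.
move=> n_gt0 noloop conn b_gt0 Lp_pinv [_ [rkC spanC]] sumP lohi.
move=> A D Dinv fhat z g z_le1 g_mono g_faces.
have AC0 : A *m C = 0.
  (* The bound m + 1 - n <= m - rank A follows from rank A < n once the right side is written (m +
     1) - (rank A + 1). *)
  apply: (spanning_kernel spanC); rewrite rkC -[X in (_ <= X)%N]subSS.
  by rewrite leq_sub2l // mxrank_incidence.
(* A version of g that agrees with it on the box and is continuous along whole lines, which leave
   the box. *)
pose gc l := C^T *m map_mx (@asinc R) (z l).
have gcE l : in_box lo hi l -> gc l = g l.
  move=> l_box; congr (_ *m _); apply/matrixP=> e j.
  by rewrite ord1 !mxE asinc_def //; have := z_le1 l l_box e; rewrite !mxE.
pose F l := \sum_e b e * asin_primitive (z l e 0).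
have zc (T : topologicalType) (X : T -> 'cV[R]_(m.+1 - n)) e :
    (forall i, continuous (fun x => X x i 0)) -> continuous (fun x => z (X x) e 0).
  move=> X_cont; under eq_fun do rewrite mxE; move=> x.
  by apply: cvgD; [exact: cvg_cst | exact: continuous_mulmx_coord].
have [ls [ls_box gls0]] : exists ls, in_box lo hi ls /\ g ls = 0.
  suff [ls [ls_box gls0]] : exists ls, in_box lo hi ls /\ gc ls = 0.
    by exists ls; rewrite -gcE.
  apply: (box_gradient_root (F := F)) => //.
  - apply: continuous_sum => e.
    have zce : continuous (fun u : 'rV[R]_(m.+1 - n) => z u^T e 0).
      apply: zc => i; under eq_fun do rewrite mxE; exact: coord_continuous.
    apply: continuous_mull => u.
    exact: (continuous_comp (zce u) (@continuous_asin_primitive R _)).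
  - move=> l i; apply: continuous_mulmx_coord => e.
    under eq_fun do rewrite mxE.
    have zce : continuous (fun t : R => z (l + t *: delta_mx i 0) e 0).
      apply: zc => k; under eq_fun do rewrite mxE [X in _ + X]mxE.
      by move=> t; apply: cvgD; [exact: cvg_cst | apply: cvgM; [exact: cvg_id | exact: cvg_cst]].
    by move=> t; exact: (continuous_comp (zce t) (@continuous_asinc R _)).
  - move=> l l' l_box l'_box.
    (* The weights in F cancel the inverse weights in z: D (z l' - z l) = C (l' - l). The
       subgradient inequality then splits into one scalar inequality per edge. *)
    have -> : (gc l')^T *m (l' - l) =
              (map_mx (@asinc R) (z l'))^T *m (D *m (z l' - z l)).
      rewrite trmx_mul trmxK -mulmxA; congr (_ *m _).
      have -> : z l' - z l = Dinv *m (C *m (l' - l)).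
        by rewrite /z opprD addrACA subrr add0r -mulmxBr mulmxA.
      by rewrite diagm_mulVK.
    have gradE (x y : 'cV[R]_m) : ((map_mx (@asinc R) y)^T *m (D *m (y - x))) 0 0 =
        \sum_e b e * (asinc (y e 0) * (y e 0 - x e 0)).
      by rewrite mxE; apply: eq_bigr => e _; rewrite diagm_mulE !mxE mulrCA.
    rewrite gradE /F -sumrB; apply: ler_sum => e _.
    rewrite -mulrBr ler_wpM2l ?(ltW (b_gt0 _)) //.
    by apply: asin_primitive_convex; exact: z_le1.
  - by move=> i j l l' lb lb'; rewrite !gcE //; exact: g_mono.
  - move=> i; rewrite !gcE; first exact: g_faces.
      by move=> k; rewrite mxE; case: ifP; rewrite lexx lohi.
    by move=> k; rewrite mxE; case: ifP; rewrite lexx lohi.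
split; first by exists ls.
have [th asin_th] := orthogonal_kernel spanC gls0.
have z_itv e : -1 <= z ls e 0 <= 1 by rewrite -ler_norml z_le1.
exists th; split=> [|e].
  have -> : map_mx sin (A^T *m th) = z ls.
    rewrite -asin_th; apply/matrixP=> e j.
    by rewrite ord1 [LHS]mxE [map_mx _ _ _ _]mxE asinK // in_itv /= z_itv.
  (* A D z(ls) = A fhat + A C ls = L Lp P + 0 = P. *)
  rewrite /z -(mulmxA Dinv) -mulmxDr -(mulmxA A) diagm_mulVK // mulmxDr.
  by rewrite (mulmxA A C) AC0 mul0mx addr0 /fhat !mulmxA (laplacian_pinv noloop).
rewrite -(mul_incidence_trE noloop th e 0) -asin_th mxE ler_norml.
by rewrite asin_geNpi2 ?asin_lepi2.
Qed.
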